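(* Every 1-tough $(K_1\cup P_3)$-free graph is hamiltonian.
   Context: All graphs are finite, undirected, without loops or multiple edges, and have at least one vertex. $P_i$ denotes the path on $i$ vertices; $K_1\cup P_3$ is the disjoint union of a single vertex and a path on three vertices. A graph $G$ is $H$-free if no induced subgraph of $G$ is isomorphic to $H$. For $S\subseteq V(G)$, $G\backslash S$ is the subgraph of $G$ induced by $V(G)\backslash S$, and $s(G\backslash S)$ is its number of connected components. A graph $G$ is $t$-tough if $|S|\ge t\,s(G\backslash S)$ for every subset $S\subseteq V(G)$ with $s(G\backslash S)>1$; the case $t=1$ is 1-tough. (Here $S=\emptyset$ is allowed, and complete graphs are $t$-tough for every $t$.) Cycle convention: a cycle of length $t$ is a sequence $v_1v_2\ldots v_tv_1$ of distinct vertices $v_1,\ldots,v_t$ with $v_iv_{i+1}\in E(G)$ for each $i$ (where $v_{t+1}=v_1$). A single vertex is regarded as a cycle of length 1 and a single edge as a cycle of length 2. A graph of order $n$ (number of vertices) is hamiltonian if it contains a cycle of length $n$ (a Hamilton cycle). In particular $K_1$ and $K_2$ count as hamiltonian. *)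

(* Defs.v *)
From mathcomp Require Import all_boot.

Set Implicit Arguments.
Unset Strict Implicit.
Unset Printing Implicit Defensive.

(* Finite simple graphs.  The empty graph is allowed here, because deleting all
   vertices of a graph yields it; nonemptiness is assumed where it is needed. *)
Record sgraph := SGraph {
  vertex :> finType;
  adj : rel vertex;
  adj_sym : symmetric adj;
  adj_irr : irreflexive adj }.

Section Induced.
Variables (G : sgraph) (S : {set G}).

Definition induced_adj : rel {x : G | x \in S} :=
  fun x y => adj (val x) (val y).

Lemma induced_sym : symmetric induced_adj.
Proof. by move=> x y; apply: adj_sym. Qed.

Lemma induced_irr : irreflexive induced_adj.
Proof. by move=> x; apply: adj_irr. Qed.

Definition induced : sgraph := SGraph induced_sym induced_irr.
End Induced.

Definition graph_iso (G H : sgraph) : Prop :=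
  exists2 f : G -> H, bijective f & forall x y, adj (f x) (f y) = adj x y.

Definition graph_free (H G : sgraph) : Prop :=
  forall S : {set G}, ~ graph_iso (induced S) H.

Section CompleteGraph.
Variable n : nat.

Definition complete_adj : rel 'I_n := fun i j => i != j.

Lemma complete_sym : symmetric complete_adj.
Proof. by move=> i j; apply: (congr1 negb (eq_sym i j)). Qed.

Lemma complete_irr : irreflexive complete_adj.
Proof. by move=> i; rewrite /complete_adj /= eqxx. Qed.

Definition complete_graph : sgraph := SGraph complete_sym complete_irr.
End CompleteGraph.

Section PathGraph.
Variable n : nat.

Definition path_adj : rel 'I_n := fun i j => (i.+1 == j) || (j.+1 == i).

Lemma path_adj_sym : symmetric path_adj.
Proof. by move=> i j; apply: orbC. Qed.

Lemma path_adj_irr : irreflexive path_adj.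
Proof. by move=> i; rewrite /path_adj /= orbb gtn_eqF. Qed.

Definition path_graph : sgraph := SGraph path_adj_sym path_adj_irr.
End PathGraph.

Section DisjointUnion.
Variables G H : sgraph.

Definition union_adj : rel (G + H)%type := fun u v =>
  match u, v with
  | inl x, inl y => adj x y
  | inr x, inr y => adj x y
  | _, _ => false
  end.

Lemma union_sym : symmetric union_adj.
Proof. by move=> [x|x] [y|y] //=; rewrite adj_sym. Qed.

Lemma union_irr : irreflexive union_adj.
Proof. by move=> [x|x] /=; rewrite adj_irr. Qed.

Definition disjoint_union : sgraph := SGraph union_sym union_irr.
End DisjointUnion.

Definition components (G : sgraph) : nat := n_comp (@adj G) [set: G].

Definition delete (G : sgraph) (S : {set G}) : sgraph := induced (~: S).

(* t-toughness, i.e. |S| >= t s(G \ S) whenever s(G \ S) > 1, at t = 1. *)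
Definition one_tough (G : sgraph) : Prop :=
  forall S : {set G}, 1 < components (delete S) -> components (delete S) <= #|S|.

(* A single vertex is a cycle of length 1; [cycle adj [:: x]] would require a
   loop at x, hence the separate case.  For an edge xy, [:: x; y] is a cycle of
   length 2. *)
Definition is_cycle (G : sgraph) (c : seq G) : bool :=
  [&& 0 < size c, uniq c & (size c == 1) || cycle (@adj G) c].

Definition hamiltonian (G : sgraph) : Prop :=
  exists2 c : seq G, is_cycle c & size c = #|G|.

(* Main.v *)
(* Let c be a longest cycle, h a vertex off c, H the component of h in G - c,
   and S the set of neighbours of H on c.  As c is longest, the successors on c
   of the vertices of S lie outside S and are pairwise nonadjacent.  The graph
   G - S - H consists of nonneighbours of h, so it is P_3-free, that is, a
   disjoint union of cliques, and the |S| successors lie in distinct cliques.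
   Together with H this gives more than |S| components of G - S, against
   1-toughness. *)
Require Import Defs.
From mathcomp Require Import all_boot.

Set Implicit Arguments.
Unset Strict Implicit.
Unset Printing Implicit Defensive.

(** Reduces a forbidden induced subgraph to an explicit map: [g] is a bijection onto its image, and
    its inverse is the isomorphism excluded by [graph_free]. *)
Lemma graph_free_embedding (H G : sgraph) (g : H -> G) :
  graph_free H G -> injective g -> ~ (forall x y, adj (g x) (g y) = adj x y).
Proof.
move=> freeG g_inj g_adj.
have gP x : g x \in g @: [set: H] by rewrite imset_f.
pose g' x : induced (g @: [set: H]) := exist _ (g x) (gP x).
have g'_inj : injective g' by move=> x y /(congr1 val) /g_inj.
have card_eq : #|induced (g @: [set: H])| <= #|H|.
  by rewrite card_sig (leq_trans (leq_imset_card g _)) ?cardsT.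
have [f g'K fK] := inj_card_bij g'_inj card_eq.
apply: (freeG (g @: [set: H])); exists f; first by exists g'.
by move=> x y; rewrite -{2}(fK x) -{2}(fK y) /= /induced_adj /= g_adj.
Qed.

(** Otherwise [h] and the path [x], [y], [z] induce $K_1\cup P_3$. *)
Lemma K1_P3_free_trans (G : sgraph) (h x y z : G) :
    graph_free (disjoint_union (complete_graph 1) (path_graph 3)) G ->
    {in [:: x; y; z], forall w, (h != w) && ~~ adj h w} ->
  adj x y -> adj y z -> x != z -> adj x z.
Proof.
move=> freeG nh xy yz xz; apply/negP => /negP xzN.
have adjN_neq (u v : G) : adj u v -> u != v.
  by move=> uv; apply: contraTneq uv => ->; rewrite adj_irr.
have /andP[hx hxN] := nh x (mem_nth x (isT : 0 < size [:: x; y; z])).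
have /andP[hy hyN] := nh y (mem_nth x (isT : 1 < size [:: x; y; z])).
have /andP[hz hzN] := nh z (mem_nth x (isT : 2 < size [:: x; y; z])).
have xyn := adjN_neq _ _ xy; have yzn := adjN_neq _ _ yz.
pose g (u : disjoint_union (complete_graph 1) (path_graph 3)) : G :=
  match u with inl _ => h | inr i => nth x [:: x; y; z] i end.
have negE := (negPf hx, negPf hy, negPf hz, negPf xyn, negPf yzn, negPf xz).
have adjE := (negPf hxN, negPf hyN, negPf hzN, xy, yz, negPf xzN).
apply: (@graph_free_embedding _ _ g freeG) => [u v guv|].
  apply/eqP; move/eqP: guv.
  case: u v => [i|[[|[|[|//]]] ?]] [j|[[|[|[|//]]] ?]] //=;
    by rewrite ?(ord1 i) ?(ord1 j) ?eqxx // ?negE // eq_sym negE.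
case=> [i|[[|[|[|//]]] ?]] [j|[[|[|[|//]]] ?]] //=;
  rewrite /path_adj /complete_adj ?(ord1 i) ?(ord1 j) ?eqxx ?adj_irr ?adjE //=;
  by rewrite adj_sym adjE.
Qed.

(** Such an [f] is constant on components, so each of its values is taken at the root of some
    component. Components are thus bounded below by counting labels. *)
Lemma card_imset_components (G : sgraph) (rT : finType) (f : G -> rT)
    (S : {set G}) :
    {in ~: S &, forall x y, adj x y -> f x = f y} ->
  #|f @: ~: S| <= components (delete S).
Proof.
move=> f_adj.
have sym_con : connect_sym (@adj (delete S)).
  exact/sym_connect_sym/adj_sym.
have f_con (x y : delete S) : connect (@adj _) x y -> f (val x) = f (val y).
  move=> /connectP[p + ->]; elim: p x => //= z p IHp x /andP[xz /IHp <-].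
  exact: f_adj (valP x) (valP z) xz.
pose R := [set x : delete S | x \in roots (@adj (delete S))].
have -> : components (delete S) = #|R|.
  by apply: eq_card => x; rewrite !inE andbT.
apply: leq_trans (leq_imset_card (f \o val) R).
apply/subset_leq_card/subsetP => _ /imsetP[x xS ->].
apply/imsetP; exists (root (@adj (delete S)) (exist _ x xS)).
  by rewrite inE; apply: roots_root.
exact/(f_con (exist _ x xS))/connect_root.
Qed.

Definition longest_cycle (G : sgraph) (c : seq G) : Prop :=
  is_cycle c /\ forall c' : seq G, is_cycle c' -> size c' <= size c.

Lemma longest_cycle_exists (G : sgraph) :
  0 < #|G| -> exists c : seq G, longest_cycle c.
Proof.
move=> /card_gt0P[x _].
pose P n := [exists t : n.-tuple G, is_cycle t].
have P_cycle (c : seq G) : is_cycle c -> P (size c).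
  by move=> cyc; apply/existsP; exists (in_tuple c).
have exP : exists n, P n by exists 1; apply: (P_cycle [:: x]).
have boundP n : P n -> n <= #|G|.
  case/existsP=> t /and3P[_ Ut _].
  by rewrite -(size_tuple t) -(card_uniqP Ut) max_card.
case: (ex_maxnP exP boundP) => n /existsP[t cyc_t] max_n.
by exists t; split=> // c' /P_cycle /max_n; rewrite size_tuple.
Qed.

(** The edges of $G - c$, kept as a relation on [G] to avoid a subtype; for [h] off [c],
    [connect (off c) h] is the component $H$. *)
Definition off (G : sgraph) (c : seq G) : rel G :=
  fun x y => [&& adj x y, x \notin c & y \notin c].

(* The set S of the proof idea. *)
Definition attachment (G : sgraph) (c : seq G) (h : G) : {set G} :=
  [set x in c | [exists y, connect (off c) h y && adj x y]].

Lemma connect_off_notin (G : sgraph) (c : seq G) (h y : G) :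
  h \notin c -> connect (off c) h y -> y \notin c.
Proof.
move=> hc /connectP[p + ->]; elim: p h hc => //= z p IHp h hc.
by case/andP=> /and3P[_ _ zc]; apply: IHp.
Qed.

Lemma connect_off_sym (G : sgraph) (c : seq G) : connect_sym (off c).
Proof.
by apply: sym_connect_sym => x y; rewrite /off adj_sym; congr (_ && _); apply: andbC.
Qed.

(** If both ends had neighbours in $H$, a path inside $H$ would close [a :: r] to a cycle longer
    than [c]. *)
Lemma spanning_path_ends (G : sgraph) (c : seq G) (h a : G) (r : seq G) :
    longest_cycle c -> h \notin c -> perm_eq (a :: r) c -> path (@adj G) a r ->
  a \in attachment c h -> last a r \notin attachment c h.
Proof.
move=> [/and3P[_ Uc _] max_c] hc eq_c ar.
rewrite inE => /andP[_ /existsP[y /andP[hy ay]]]; apply/negP.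
rewrite inE => /andP[_ /existsP[z /andP[hz rz]]].
have yz : connect (off c) z y by apply: connect_trans hy; rewrite connect_off_sym.
have zc := connect_off_notin hc hz.
case/connectP: yz => p0 zp0 def_y; rewrite {y}def_y in hy ay.
(* The walk from [z] to [y] is made repetition-free, as a cycle requires. *)
case/shortenP: zp0 ay => p zp Up _ ay {hy}.
have pc : {in z :: p, forall w, w \notin c}.
  move=> w wp; apply: connect_off_notin zc _; apply/connectP.
  by case/splitPl: wp zp => p1 p2 <-; rewrite cat_path => /andP[? _]; exists p1.
have zp' : path (@adj G) z p by apply: sub_path zp => u v /and3P[].
have /max_c : is_cycle ((z :: p) ++ a :: r).
  apply/and3P; split=> //; last first.
    by rewrite /= rcons_cat cat_path zp' /= adj_sym ay rcons_path ar rz orbT.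
  rewrite cat_uniq Up (perm_uniq eq_c) Uc andbT.
  by apply/hasPn => w; rewrite (perm_mem eq_c); apply: contraL => /pc.
by rewrite size_cat (perm_size eq_c) /= addSn ltnNge leq_addl.
Qed.

(** Cuts the cycle open just after [x]. *)
Lemma next_rot_path (G : sgraph) (c : seq G) (x : G) :
    is_cycle c -> x \in c ->
  exists n s, [/\ rot n c = next c x :: s, path (@adj G) (next c x) s
                & last (next c x) s = x].
Proof.
case/and3P=> _ Uc cyc_c xc; have [i s def_c] := rot_to xc.
have next_x : next c x = head x (rcons s x).
  by rewrite -(next_rot i Uc) def_c; case: (s) => [|a s'] /=; rewrite eqxx.
have [n def_n] : exists n, rot n c = rcons s x.
  by eexists; rewrite -rot1_cons -def_c rot_rot_add.
(* On a cycle of length 1 the successor of [x] is [x] itself and the path is trivial. *)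
case: s => [|a s] /= in next_x def_n {def_c}; exists n; rewrite next_x.
  by exists [::].
exists (rcons s x); split; rewrite ?last_rcons //.
case/orP: cyc_c => [/eqP c1|].
  by move/(congr1 size): def_n; rewrite size_rot c1 /= size_rcons.
by rewrite -(rot_cycle n) def_n /= rcons_path => /andP[].
Qed.

Lemma next_notin_attachment (G : sgraph) (c : seq G) (h x : G) :
    longest_cycle c -> h \notin c -> x \in attachment c h ->
  next c x \notin attachment c h.
Proof.
move=> long_c hc xS; have xc : x \in c by move: xS; rewrite inE => /andP[].
have [n [s [def_c path_s last_s]]] := next_rot_path long_c.1 xc.
apply/negP => aS; have := spanning_path_ends long_c hc _ path_s aS.
by rewrite last_s xS -def_c perm_rot perm_refl => /(_ isT).
Qed.

(** An edge between the successors would give a path spanning [c] with both ends in the attachment: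
    from [x] backwards to the successor of [y], over the edge, then forwards to [y]. *)
Lemma next_attachment_nonadj (G : sgraph) (c : seq G) (h x y : G) :
    longest_cycle c -> h \notin c ->
    x \in attachment c h -> y \in attachment c h -> x != y ->
  ~~ adj (next c x) (next c y).
Proof.
move=> long_c hc xS yS xy; have [cyc_c _] := long_c.
have [_ Uc _] := and3P cyc_c.
have xc : x \in c by move: xS; rewrite inE => /andP[].
have yc : y \in c by move: yS; rewrite inE => /andP[].
have [n [s [def_c path_s last_s]]] := next_rot_path cyc_c xc.
move: (next c x) => a in def_c path_s last_s *.
have Ur : uniq (a :: s) by rewrite -def_c rot_uniq.
have ya : y \in a :: s by rewrite -def_c mem_rot.
have next_y : next c y = next (a :: s) y by rewrite -def_c next_rot.
have [s1 [b [s2 [def_s last_s1]]]] :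
    exists s1 b s2, s = s1 ++ b :: s2 /\ last a s1 = y.
  case/splitPl: ya last_s => s1 [|b s2] last_s1; last by exists s1, b, s2.
  by rewrite cats0 last_s1 => yx; rewrite yx eqxx in xy.
have def_b : next c y = b.
  rewrite next_y next_nth ya.
  have -> : index y (a :: s) = size s1.
    rewrite def_s -last_s1 -cat_cons lastI cat_rcons index_cat.
    move: Ur; rewrite def_s -cat_cons lastI cat_rcons cat_uniq /=.
    rewrite negb_or => /and3P[_ /andP[/negPf-> _] _].
    by rewrite eqxx addn0 size_belast.
  by rewrite def_s nth_cat ltnn subnn.
rewrite def_b; apply/negP => ab.
(* Reversing the part after [y] yields a path from [x] to [y]. *)
pose r := rev (belast b s2) ++ a :: s1.
have def_x : last b s2 = x by rewrite -last_s def_s last_cat.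
have perm_r : perm_eq (x :: r) c.
  rewrite perm_sym -(perm_rot n c) def_c def_s -cat_cons perm_catC.
  rewrite /r -cat_cons -def_x -rev_rcons -lastI.
  by rewrite perm_cat2r perm_sym perm_rev.
move: path_s; rewrite def_s cat_path /= => /and3P[path_s1 _ path_s2].
have path_r : path (@adj G) x r.
  rewrite cat_path -{1}def_x rev_path.
  rewrite (eq_path (e' := @adj G)) ?path_s2 /=; last first.
    by move=> u v; rewrite adj_sym.
  rewrite path_s1 andbT.
  (* If [s2] is empty, then [b] is [x] and the reversed part is [x] alone. *)
  have -> : last x (rev (belast b s2)) = b.
    by rewrite -def_x; case: (s2) => //= d s3; rewrite rev_cons last_rcons.
  by rewrite adj_sym.
have := spanning_path_ends long_c hc perm_r path_r xS.
by rewrite last_cat /= last_s1 yS.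
Qed.

Theorem theorem2 (G : sgraph) (G_nonempty : 0 < #|G|)
    (G_tough : one_tough G)
    (G_free : graph_free (disjoint_union (complete_graph 1) (path_graph 3)) G) :
  hamiltonian G.
Proof.
have [c long_c] := longest_cycle_exists G_nonempty.
have [cyc_c _] := long_c; have [c_gt0 Uc _] := and3P cyc_c.
exists c => //; apply/eqP; rewrite -(card_uniqP Uc) eqn_leq max_card leqNgt /=.
apply/negP; rewrite -(cardC (mem c)) -subn_gt0 addKn => /card_gt0P[h hc].
rewrite !inE /= in hc.
pose S := attachment c h; pose H := [pred z | connect (off c) h z].
have SP x : x \in S -> x \in c by rewrite inE => /andP[].
have HN z : H z -> (z \notin c) && (z \notin S).
  by move=> /(connect_off_notin hc) zc; rewrite zc; apply: contra zc => /SP.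
have H_closed y z : H y -> adj y z -> z \notin S -> H z.
  move=> Hy yz; rewrite inE negb_and => zS; have /andP[yc _] := HN y Hy.
  have zc : z \notin c.
    apply: contraTN zS => zc; rewrite zc negbK /=.
    by apply/existsP; exists y; rewrite adj_sym yz andbT.
  by apply: connect_trans Hy (connect1 _); rewrite /off yz yc zc.
(* For [z] outside [S] and [H], the closed neighbourhood of [z] in $G - S - H$, hence its clique. *)
pose N z := [set w in ~: S | ~~ H w & (w == z) || adj w z].
have inN w z : (w \in N z) = [&& w \notin S, ~~ H w & (w == z) || adj w z].
  by rewrite in_set in_setC.
(* [f] labels the components of [G - S]: [set h] for [H], and the clique itself
   for the others. *)
pose f z := if H z then [set h] else N z.
have f_adj : {in ~: S &, forall x y, adj x y -> f x = f y}.
  have sub_N x y : x \notin S -> y \notin S -> ~~ H x -> ~~ H y ->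
      adj x y -> N x \subset N y.
    move=> xS yS Hx Hy xy; apply/subsetP => w; rewrite !inN.
    case/and3P=> wS Hw wx; rewrite wS Hw /=.
    case/predU1P: wx => [->|wx]; first by rewrite xy orbT.
    case: eqVneq => //= wy.
    apply: (@K1_P3_free_trans G h w x y) => // u u_in.
    have {u_in} [uS Hu] : u \notin S /\ ~~ H u.
      by move: u_in; rewrite !in_cons in_nil orbF => /or3P[]/eqP->.
    (* A vertex outside [S] and [H] is neither [h] nor adjacent to it, since [H] is closed under
       adjacency outside [S]. *)
    apply/andP; split; first by apply: contraNneq Hu => <-; apply: connect0.
    by apply: contra Hu => hu; apply: H_closed hu uS; apply: connect0.
  move=> x y; rewrite !in_setC => xS yS xy; have yx := xy; rewrite adj_sym in yx.
  rewrite /f; case: ifPn => Hx; case: ifPn => Hy //.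
  - by rewrite (H_closed x y) in Hy.
  - by rewrite (H_closed y x) in Hx.
  - by apply/eqP; rewrite eqEsubset !sub_N.
have Hc x : x \in c -> ~~ H x.
  by move=> xc; apply/negP => /HN; rewrite xc.
pose T := [set x in c] :\: S.
have next_T x : x \in S -> next c x \in T.
  move=> xS; rewrite in_setD inE mem_next SP // andbT.
  exact: next_notin_attachment.
(* Successors with the same label are equal or adjacent; the latter is excluded for distinct
   vertices of [S]. *)
have f_next : {in S &, injective (f \o next c)}.
  move=> x y xS yS /=; rewrite /f !ifN ?Hc ?mem_next ?SP // => Nxy.
  have: next c x \in N (next c x).
    have := next_T x xS; rewrite in_setD => /andP[nxS _].
    by rewrite inN nxS Hc ?mem_next ?SP // eqxx.
  rewrite Nxy inN => /and3P[_ _ /predU1P[/(can_inj (prev_next Uc))//|nxy]].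
  apply/eqP; apply: contraTT nxy => xy.
  exact: next_attachment_nonadj long_c hc xS yS xy.
have card_T : #|S| <= #|f @: T|.
  rewrite -(card_in_imset f_next) imset_comp subset_leq_card // imsetS //.
  by apply/subsetP => _ /imsetP[x xS ->]; apply: next_T.
(* Toughness applies only to more than one component; this supplies a label besides that of [H] even
   if [S] is empty. *)
have T_gt0 : 0 < #|f @: T|.
  rewrite card_gt0; have [x xc] : exists x, x \in c.
    by case: (c) c_gt0 => // x c' _; exists x; rewrite mem_head.
  apply/set0Pn; have [xS|xS] := boolP (x \in S).
    by exists (f (next c x)); rewrite imset_f ?next_T.
  by exists (f x); rewrite imset_f // in_setD xS inE.
have card_f : #|f @: T| < #|f @: ~: S|.
  apply/proper_card/properP; split.
    by apply: imsetS; apply/subsetP => x; rewrite in_setD in_setC => /andP[].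
  exists (f h).
    by rewrite imset_f // in_setC; have /andP[_] := HN h (connect0 _ _).
  (* The label of [H] contains [h], whereas the labels on [T] avoid [H]. *)
  apply/imsetP => -[x]; rewrite in_setD inE => /andP[_ xc].
  rewrite /f (ifT _ _ (connect0 _ _ : H h)) ifN ?Hc // => /setP/(_ h).
  by rewrite inN set11 /H /= connect0 andbF.
have comp_f := card_imset_components f_adj.
have := G_tough S (leq_trans (leq_ltn_trans T_gt0 card_f) comp_f).
by rewrite leqNgt (leq_trans (leq_ltn_trans card_T card_f) comp_f).
Qed.
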